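(* For independent symmetric real random variables $\xi$ and $\eta$, the following inequalities are valid: $$2^{\rho-2}\left(\mathbf{E}|\xi|^\rho+\mathbf{E}|\eta|^\rho\right)\le \mathbf{E}|\xi+\eta|^\rho\le \mathbf{E}|\xi|^\rho+\mathbf{E}|\eta|^\rho\quad\text{if } 0<\rho\le 2,$$ $$\mathbf{E}|\xi|^\rho+\mathbf{E}|\eta|^\rho\le \mathbf{E}|\xi+\eta|^\rho\le 2^{\rho-2}\left(\mathbf{E}|\xi|^\rho+\mathbf{E}|\eta|^\rho\right)\quad\text{if } \rho\ge 2,$$ when $\mathbf{E}|\xi|^\rho<\infty$ and $\mathbf{E}|\eta|^\rho<\infty$. The four estimates for $\mathbf{E}|\xi+\eta|^\rho$ are sharp in the sense that, for each inequality, there exist distributions of (independent symmetric) $\xi$ and $\eta$ such that $\xi\ne 0$ (that is, $\xi$ is not almost surely zero) and the inequality turns into equality for these distributions.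
   Context: A random variable $\xi$ is symmetric if $\xi$ and $-\xi$ have the same distribution. Here $\rho$ is a real number. *)

(* Defs.v *)
From HB Require Import structures.
From mathcomp Require Import all_boot all_order all_algebra.
From mathcomp Require Import all_classical all_reals all_analysis.
From mathcomp Require Import measurable_realfun.
Set Implicit Arguments.
Unset Strict Implicit.
Unset Printing Implicit Defensive.
Import Order.TTheory GRing.Theory Num.Theory.
Import numFieldNormedType.Exports.
Local Open Scope classical_set_scope.
Local Open Scope ring_scope.

Definition independent_RV d (T : measurableType d) (R : realType)
    (P : probability T R) (X Y : {RV P >-> R}) : Prop :=
  forall A B : set R, measurable A -> measurable B ->
    P (X @^-1` A `&` Y @^-1` B) = (P (X @^-1` A) * P (Y @^-1` B))%E.

(* Equality of laws is tested on Borel sets only: [distribution] is a total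
   function on [set R], and its values off the sigma-algebra are irrelevant. *)
Definition symmetric_RV d (T : measurableType d) (R : realType)
    (P : probability T R) (X : {RV P >-> R}) : Prop :=
  forall A : set R, measurable A ->
    distribution P X A = distribution P (- X : {mfun T >-> R}) A.

Definition abs_moment d (T : measurableType d) (R : realType)
    (P : probability T R) (rho : R) (X : T -> R) : \bar R :=
  ('E_P[fun w => (`|X w| `^ rho)%R])%E.

Definition admissible_pair d (T : measurableType d) (R : realType)
    (P : probability T R) (rho : R) (X Y : {RV P >-> R}) : Prop :=
  [/\ independent_RV X Y, symmetric_RV X, symmetric_RV Y,
      (abs_moment P rho X < +oo)%E & (abs_moment P rho Y < +oo)%E].

Definition not_as_zero d (T : measurableType d) (R : realType)
    (P : probability T R) (X : {RV P >-> R}) : Prop :=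
  ~ {ae P, forall w, X w = 0}.

(* Main.v *)
(* Symmetry of [eta] and independence give [(xi, eta)] and [(xi, - eta)] the
   same law, so [2 E|xi + eta|^rho = E(|xi + eta|^rho + |xi - eta|^rho)], and
   the four bounds follow from Clarkson's pointwise inequalities for
   [|x + y|^rho + |x - y|^rho].  These come from writing [|x|^rho] as
   [(x^2)^(rho/2)]: one uses convexity or concavity of [t^(rho/2)] at the
   midpoint [x^2 + y^2] of [(x + y)^2] and [(x - y)^2], then super- or
   subadditivity.  Equality holds pointwise when [eta = 0], and when [xi] and
   [eta] both take only the values [1] and [- 1]. *)

Require Import Defs.
From HB Require Import structures.
From mathcomp Require Import all_boot all_order all_algebra.
From mathcomp Require Import all_classical all_reals all_analysis.
From mathcomp Require Import measurable_realfun.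
From mathcomp Require Import ring lra.
Set Implicit Arguments.
Unset Strict Implicit.
Unset Printing Implicit Defensive.
Import Order.TTheory GRing.Theory Num.Theory.
Import numFieldNormedType.Exports.
Local Open Scope ring_scope.
Local Open Scope ereal_scope.

(** * Real powers and Clarkson's pointwise inequalities *)

Section powR_inequalities.
Local Open Scope ring_scope.
Context {R : realType}.
Implicit Types a b p r x y : R.

Lemma powRVK p a : p != 0 -> 0 <= a -> (a `^ p^-1) `^ p = a.
Proof. by move=> p0 a0; rewrite -powRrM mulVf// powRr1. Qed.

Lemma powRKV p a : p != 0 -> 0 <= a -> (a `^ p) `^ p^-1 = a.
Proof. by move=> p0 a0; rewrite -powRrM divff// powRr1. Qed.

(** Writing t^p as t t^(p-1) splits the right side into a (a+b)^(p-1) + b (a+b)^(p-1), and t^(p-1)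
    is nondecreasing since p - 1 is nonnegative. *)
Lemma powR_superadditive p a b : 1 <= p -> 0 <= a -> 0 <= b ->
  a `^ p + b `^ p <= (a + b) `^ p.
Proof.
move=> p1 a0 b0; have p0 : 0 < p by exact: lt_le_trans p1.
have q0 : 0 <= p - 1 by rewrite subr_ge0.
rewrite -3?(@mulr_powRB1 _ _ p) ?addr_ge0// mulrDl.
by apply: lerD; apply: ler_wpM2l => //; apply: ge0_ler_powR => //;
  rewrite ?nnegrE ?addr_ge0 ?lerDl ?lerDr.
Qed.

(** This is superadditivity for the exponent 1/p, at least 1, applied to a^p and b^p, with both
    sides then raised to the power p. *)
Lemma powR_subadditive p a b : 0 < p -> p <= 1 -> 0 <= a -> 0 <= b ->
  (a + b) `^ p <= a `^ p + b `^ p.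
Proof.
move=> p0 p1 a0 b0; have pN0 : p != 0 by rewrite gt_eqF.
rewrite -[leRHS](powRVK pN0) ?addr_ge0 ?powR_ge0//.
apply: ge0_ler_powR; rewrite ?nnegrE ?addr_ge0 ?powR_ge0 ?(ltW p0)//.
rewrite -[X in X + _ <= _](powRKV pN0)// -[X in _ + X <= _](powRKV pN0)//.
by apply: powR_superadditive; rewrite ?powR_ge0// invf_ge1.
Qed.

Lemma powR_midpoint_convex p a b : 1 <= p -> 0 <= a -> 0 <= b ->
  ((a + b) / 2) `^ p <= (a `^ p + b `^ p) / 2.
Proof.
move=> p1 a0 b0.
have h0 : 0 <= 2^-1 :> R by rewrite invr_ge0.
have h1 : 2^-1 <= 1 :> R by lra.
have := @convex_powR R p p1 (Itv01 h0 h1) a b.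
rewrite !inE/= !in_itv/= !andbT => /(_ a0 b0).
rewrite ![conv _ _ _]convRE/= /unstable.onem.
have -> : 1 - 2^-1 = 2^-1 :> R by lra.
by rewrite -!mulrDr mulrC [leRHS]mulrC.
Qed.

(** The same inversion: midpoint convexity for the exponent 1/p at the points a^p and b^p. *)
Lemma powR_midpoint_concave p a b : 0 < p -> p <= 1 -> 0 <= a -> 0 <= b ->
  (a `^ p + b `^ p) / 2 <= ((a + b) / 2) `^ p.
Proof.
move=> p0 p1 a0 b0; have pN0 : p != 0 by rewrite gt_eqF.
have s0 : 0 <= (a `^ p + b `^ p) / 2 by rewrite divr_ge0 ?addr_ge0 ?powR_ge0.
rewrite -[leLHS](powRVK pN0)//.
apply: ge0_ler_powR; rewrite ?nnegrE ?powR_ge0 ?divr_ge0 ?addr_ge0 ?(ltW p0)//.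
rewrite -[X in _ <= (X + _) / _](powRKV pN0)//
  -[X in _ <= (_ + X) / _](powRKV pN0)//.
by apply: powR_midpoint_convex; rewrite ?powR_ge0// invf_ge1.
Qed.

Lemma normr_powR_sqr r x : `|x| `^ r = (x ^+ 2) `^ (r / 2).
Proof.
by rewrite -real_normK ?num_real// -powR_mulrn// -powRrM mulrC divfK.
Qed.

Let midpoint_sqr x y :
  ((x + y) ^+ 2 + (x - y) ^+ 2) / 2 = x ^+ 2 + y ^+ 2.
Proof. by lra. Qed.

Lemma clarkson_le2 r x y : 0 < r -> r <= 2 ->
  `|x + y| `^ r + `|x - y| `^ r <= 2 * (`|x| `^ r + `|y| `^ r).
Proof.
move=> r0 r2; rewrite !normr_powR_sqr [leRHS]mulrC -ler_pdivrMr//.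
have p0 : 0 < r / 2 by lra.
have p1 : r / 2 <= 1 by lra.
rewrite (le_trans (powR_midpoint_concave p0 p1 _ _)) ?sqr_ge0//.
by rewrite midpoint_sqr powR_subadditive ?sqr_ge0.
Qed.

Lemma clarkson_ge2 r x y : 2 <= r ->
  2 * (`|x| `^ r + `|y| `^ r) <= `|x + y| `^ r + `|x - y| `^ r.
Proof.
move=> r2; rewrite !normr_powR_sqr [leLHS]mulrC -ler_pdivlMr//.
have p1 : 1 <= r / 2 by lra.
rewrite (le_trans _ (powR_midpoint_convex p1 _ _)) ?sqr_ge0//.
by rewrite midpoint_sqr powR_superadditive ?sqr_ge0.
Qed.

(** The product is grouped around 2 times 2^(r-2), the constant carried by the dual pointwise
    bounds. *)
Lemma powR2_subr2 r : 2 * 2 `^ (r - 2) * 2 = 2 `^ r :> R.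
Proof. by rewrite powRB ?pnatr_eq0 ?implybT// powR_mulrn//; field. Qed.

(** The factor 2^r is split so that its leading 2 cancels against the 2 in Clarkson's inequality. *)
Let double_powR r x : `|x + x| `^ r = 2 * (2 * 2 `^ (r - 2)) * `|x| `^ r.
Proof.
have -> : x + x = 2 * x by lra.
by rewrite normrM normr_nat powRM// -(powR2_subr2 r) [2 * (2 * _)]mulrC.
Qed.

(* The dual inequalities are the previous ones at [x + y] and [x - y]. *)
Lemma clarkson_dual_le2 r x y : 0 < r -> r <= 2 ->
  2 * 2 `^ (r - 2) * (`|x| `^ r + `|y| `^ r) <= `|x + y| `^ r + `|x - y| `^ r.
Proof.
move=> r0 r2; have := clarkson_le2 (x + y) (x - y) r0 r2.
have -> : x + y + (x - y) = x + x by lra.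
have -> : x + y - (x - y) = y + y by lra.
by rewrite !double_powR -mulrDr -mulrA ler_pM2l.
Qed.

Lemma clarkson_dual_ge2 r x y : 2 <= r ->
  `|x + y| `^ r + `|x - y| `^ r <= 2 * 2 `^ (r - 2) * (`|x| `^ r + `|y| `^ r).
Proof.
move=> r2; have := clarkson_ge2 (x + y) (x - y) r2.
have -> : x + y + (x - y) = x + x by lra.
have -> : x + y - (x - y) = y + y by lra.
by rewrite !double_powR -mulrDr -mulrA ler_pM2l.
Qed.

End powR_inequalities.

(** * Joint laws, and the passage from pointwise bounds to moments *)

Section joint_law.
Local Open Scope classical_set_scope.
Context d (T : measurableType d) (R : realType) (P : probability T R).
Implicit Types X Y : {RV P >-> R}.

Definition pair_RV X Y (w : T) : R * R := (X w, Y w).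

Lemma measurable_pair_RV X Y : measurable_fun setT (pair_RV X Y).
Proof. by apply: measurable_fun_pair; exact: measurable_funP. Qed.

HB.instance Definition _ X Y :=
  isMeasurableFun.Build _ _ _ _ (pair_RV X Y) (measurable_pair_RV X Y).

(** [- Y] lies in [B] exactly when [Y] lies in the reflection of [B], which is again Borel, so
    independence applies to the reflected set. *)
Lemma independent_symmetricN X Y : independent_RV X Y -> symmetric_RV Y ->
  independent_RV X (- Y : {mfun T >-> R})%R.
Proof.
move=> XY sY A B mA mB; rewrite -[P (_ @^-1` B)](sY B mB).
have mNB : measurable (-%R @^-1` B : set R).
  by rewrite -[X in measurable X]setTI; exact: oppr_measurable.
by rewrite [LHS](XY A _ mA mNB) [distribution P Y B](sY B mB).
Qed.

Lemma integral_pair_RV X Y (f : R * R -> \bar R) : independent_RV X Y ->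
  measurable_fun setT f -> (forall z, 0 <= f z) ->
  \int[P]_w f (X w, Y w) =
  \int[distribution P X \x distribution P Y]_z f z.
Proof.
move=> XY mf f0.
rewrite -(ge0_integral_distribution
  (pair_RV X Y : {mfun T >-> (R * R)%type}) mf f0).
apply: eq_measure_integral => A mA _; apply/esym.
(* Independence says that the joint law has the product values on measurable rectangles, and these
   determine the product measure. *)
by apply: product_measure_unique => // B C mB mC; exact: XY.
Qed.

Lemma measurable_abs_powR (Z : T -> R) r : measurable_fun setT Z ->
  measurable_fun setT (fun w => (`|Z w| `^ r)%:E).
Proof.
move=> mZ; apply/measurable_EFinP.
apply: (measurableT_comp (measurable_powR r)).
exact: measurableT_comp.
Qed.

(** Reading [X - Y] as [X + (- Y)], both moments integrate the same [f] against product laws that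
    differ only in the second factor; symmetry makes these laws agree on rectangles. *)
Lemma abs_moment_sub X Y r : independent_RV X Y -> symmetric_RV Y ->
  abs_moment P r (X \- Y)%R = abs_moment P r (X \+ Y)%R.
Proof.
move=> XY sY; rewrite /abs_moment unlock.
pose f (z : R * R) : \bar R := (`|z.1 + z.2| `^ r)%:E.
have f0 z : 0 <= f z by rewrite lee_fin powR_ge0.
have mf : measurable_fun setT f.
  apply/measurable_EFinP; apply: (measurableT_comp (measurable_powR r)).
  by apply: measurableT_comp => //; exact: measurable_funD.
rewrite [RHS](integral_pair_RV XY mf f0).
rewrite [LHS](integral_pair_RV (independent_symmetricN XY sY) mf f0).
apply: eq_measure_integral => A mA _.
apply: product_measure_unique => // B C mB mC.
by rewrite [LHS]product_measure1E//; congr (_ * _); exact: sY.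
Qed.

Lemma abs_moment_double X Y r : independent_RV X Y -> symmetric_RV Y ->
  \int[P]_w (`|X w + Y w| `^ r + `|X w - Y w| `^ r)%:E =
  2%:E * abs_moment P r (X \+ Y)%R.
Proof.
move=> XY sY; under eq_integral do rewrite EFinD.
rewrite ge0_integralD//; last 2 first.
- by apply: (@measurable_abs_powR (X \+ Y)%R); exact: measurable_funD.
- by apply: (@measurable_abs_powR (X \- Y)%R); exact: measurable_funB.
have := abs_moment_sub r XY sY; rewrite /abs_moment unlock => ->.
by rewrite -mule2n mule_natl.
Qed.

Lemma integral_abs_momentD X Y r c : (0 <= c)%R ->
  \int[P]_w (c * (`|X w| `^ r + `|Y w| `^ r))%:E =
  c%:E * (abs_moment P r X + abs_moment P r Y).
Proof.
move=> c0; under eq_integral do rewrite EFinM EFinD.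
have p0 (Z : T -> R) w : 0 <= (`|Z w| `^ r)%:E by rewrite lee_fin powR_ge0.
have mX := measurable_abs_powR r (measurable_funP X).
have mY := measurable_abs_powR r (measurable_funP Y).
rewrite ge0_integralZl_EFin//; last 2 first.
- by move=> w _; rewrite adde_ge0.
- exact: emeasurable_funD.
by rewrite ge0_integralD// /abs_moment unlock.
Qed.

Lemma measurable_abs_powRD X Y r c :
  measurable_fun setT (fun w => (c * (`|X w| `^ r + `|Y w| `^ r))%:E).
Proof.
apply/measurable_EFinP; apply: measurable_funM => //.
by apply: measurable_funD; apply/measurable_EFinP; apply: measurable_abs_powR.
Qed.

Lemma measurable_abs_powR_sum_diff X Y r :
  measurable_fun setT (fun w => (`|X w + Y w| `^ r + `|X w - Y w| `^ r)%:E).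
Proof.
apply/measurable_EFinP; apply: measurable_funD; apply/measurable_EFinP.
- by apply: (@measurable_abs_powR (X \+ Y)%R); exact: measurable_funD.
- by apply: (@measurable_abs_powR (X \- Y)%R); exact: measurable_funB.
Qed.

(** The pointwise constant is [2 * c] because integrating the sum over both signs yields twice the
    moment of [X + Y]. *)
Lemma abs_moment_lower X Y r c : independent_RV X Y -> symmetric_RV Y ->
  (0 <= c)%R ->
  (forall w, 2 * c * (`|X w| `^ r + `|Y w| `^ r) <=
     `|X w + Y w| `^ r + `|X w - Y w| `^ r)%R ->
  c%:E * (abs_moment P r X + abs_moment P r Y) <= abs_moment P r (X \+ Y)%R.
Proof.
move=> XY sY c0 h.
rewrite -(@lee_pmul2l _ 2%:E)// muleA -EFinM -abs_moment_double//.
rewrite -integral_abs_momentD ?mulr_ge0//; apply: ge0_le_integral => //.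
- by move=> w _; rewrite lee_fin !mulr_ge0 ?addr_ge0 ?powR_ge0.
- exact: measurable_abs_powRD.
- exact: measurable_abs_powR_sum_diff.
- by move=> w _; rewrite lee_fin h.
Qed.

Lemma abs_moment_upper X Y r c : independent_RV X Y -> symmetric_RV Y ->
  (0 <= c)%R ->
  (forall w, `|X w + Y w| `^ r + `|X w - Y w| `^ r <=
     2 * c * (`|X w| `^ r + `|Y w| `^ r))%R ->
  abs_moment P r (X \+ Y)%R <= c%:E * (abs_moment P r X + abs_moment P r Y).
Proof.
move=> XY sY c0 h.
rewrite -(@lee_pmul2l _ 2%:E)// muleA -EFinM -abs_moment_double//.
rewrite -integral_abs_momentD ?mulr_ge0//; apply: ge0_le_integral => //.
- exact: measurable_abs_powR_sum_diff.
- exact: measurable_abs_powRD.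
- by move=> w _; rewrite lee_fin h.
Qed.

(** A null set covering every point where [X] is nonzero would be the whole space, of mass 1. *)
Lemma never_zero_not_as_zero X : (forall w, X w != 0%R) -> not_as_zero X.
Proof.
move=> X0 [A [mA PA0 sA]].
have AT : A = setT by apply/seteqP; split=> // w _; apply: sA; exact/eqP/X0.
by move: PA0; rewrite AT probability_setT => /eqP; rewrite onee_eq0.
Qed.

(** Every event of a constant variable is empty or the whole space. *)
Lemma independent_cst X c : independent_RV X (cst c : {RV P >-> R}).
Proof.
move=> A B _ _; rewrite preimage_cst; case: ifPn => _.
  by rewrite setIT [X in _ = _ * X]probability_setT mule1.
by rewrite setI0 measure0 mule0.
Qed.

Lemma symmetric_cst0 : symmetric_RV (cst 0%R : {RV P >-> R}).
Proof.
move=> A _; rewrite /distribution /pushforward; congr (P _).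
by apply/seteqP; split=> w /=; rewrite /= oppr0.
Qed.

(** The exponent 0 is excluded because [powR] gives 0^0 the value 1. *)
Lemma abs_moment_cst0 r : r != 0%R -> abs_moment P r (cst 0%R) = 0.
Proof.
move=> r0; rewrite /abs_moment (_ : (fun _ => _) = cst 0%R) ?expectation_cst//.
by apply/funext => w; rewrite normr0 powR0.
Qed.

End joint_law.

(** * Extremal examples built from two fair coins *)

Section rademacher.
Local Open Scope classical_set_scope.
Context {R : realType}.

Definition fair_coin : probability bool R := bernoulli_prob 2^-1%R.
Definition two_coins : probability (bool * bool)%type R :=
  fair_coin \x fair_coin.

(** The boolean is coerced to the exponent 0 or 1, so under [fair_coin] this is a Rademacher
    variable. *)
Definition sign (b : bool) : R := ((-1) ^+ b)%R.
Definition sign1 (w : bool * bool) : R := sign w.1.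
Definition sign2 (w : bool * bool) : R := sign w.2.

Lemma measurable_sign1 : measurable_fun setT sign1.
Proof. exact: (measurableT_comp (f := sign)). Qed.

Lemma measurable_sign2 : measurable_fun setT sign2.
Proof. exact: (measurableT_comp (f := sign)). Qed.

HB.instance Definition _ :=
  isMeasurableFun.Build _ _ _ _ sign1 measurable_sign1.
HB.instance Definition _ :=
  isMeasurableFun.Build _ _ _ _ sign2 measurable_sign2.

Let rad1 : {RV two_coins >-> R} := sign1.
Let rad2 : {RV two_coins >-> R} := sign2.
Let zero : {RV two_coins >-> R} := cst 0%R.

Lemma signN b : (- sign b = sign (~~ b))%R.
Proof. by case: b; rewrite /sign ?expr0 ?expr1 ?opprK. Qed.

(** Negation swaps the two Dirac masses, whose weights 1/2 and 1 - 1/2 coincide. *)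
Lemma fair_coin_negb (A : set bool) : fair_coin (negb @^-1` A) = fair_coin A.
Proof.
have p01 : (0 <= (2^-1 : R) <= 1)%R by lra.
rewrite [LHS](bernoulli_probE p01) [RHS](bernoulli_probE p01) !diracE.
have e b : (b \in negb @^-1` A) = (~~ b \in A) by apply/idP/idP; rewrite !inE.
rewrite !e /= addeC /unstable.onem.
by have -> : (1 - 2^-1 = 2^-1 :> R)%R by lra.
Qed.

Lemma two_coins_fst (A : set bool) : two_coins (fst @^-1` A) = fair_coin A.
Proof.
have -> : fst @^-1` A = A `*` [set: bool].
  by apply/seteqP; split=> [[a b]|[a b] []].
rewrite /two_coins [LHS]product_measure1E//.
by rewrite -[RHS]mule1; congr (_ * _); exact: probability_setT.
Qed.

Lemma two_coins_snd (A : set bool) : two_coins (snd @^-1` A) = fair_coin A.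
Proof.
have -> : snd @^-1` A = [set: bool] `*` A.
  by apply/seteqP; split=> [[a b]|[a b] []].
rewrite /two_coins [LHS]product_measure1E//.
by rewrite -[RHS]mul1e; congr (_ * _); exact: probability_setT.
Qed.

Lemma rad_independent : independent_RV rad1 rad2.
Proof.
move=> A B _ _; rewrite [X in _ = X * _](two_coins_fst (sign @^-1` A)).
rewrite [X in _ = _ * X](two_coins_snd (sign @^-1` B)).
exact: product_measure1E.
Qed.

(** Changing the sign of [X] amounts to flipping the bit [f w], and a fair bit is invariant under
    flipping. Both coordinate projections are instances of [f]. *)
Lemma sign_symmetric (f : bool * bool -> bool) (X : {RV two_coins >-> R}) :
  (forall A : set bool, two_coins (f @^-1` A) = fair_coin A) ->
  X = sign \o f :> (_ -> _) -> symmetric_RV X.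
Proof.
move=> ff Xf A _; rewrite /distribution /pushforward /=.
have XN w : (- X)%R w = sign (~~ f w).
  by rewrite -signN -[sign (f w)]/((sign \o f) w) -Xf.
rewrite (_ : (- X)%R @^-1` A = f @^-1` (negb @^-1` (sign @^-1` A))); last first.
  by apply/funext => w; congr (A _); exact: XN.
by rewrite Xf comp_preimage !ff fair_coin_negb.
Qed.

Lemma rad1_symmetric : symmetric_RV rad1.
Proof. exact: (@sign_symmetric fst _ two_coins_fst). Qed.

Lemma rad2_symmetric : symmetric_RV rad2.
Proof. exact: (@sign_symmetric snd _ two_coins_snd). Qed.

Lemma rad1_not_zero : not_as_zero rad1.
Proof.
by apply: never_zero_not_as_zero => w; rewrite -normr_eq0 normr_sign oner_eq0.
Qed.

Lemma abs_moment_rad (X : {RV two_coins >-> R}) r :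
  (forall w, `|X w| = 1)%R -> abs_moment two_coins r X = 1.
Proof.
move=> X1; rewrite /abs_moment (_ : (fun _ => _) = cst 1%R) ?expectation_cst//.
by apply/funext => w; rewrite X1 powR1.
Qed.

Lemma admissible_rad r : admissible_pair r rad1 rad2.
Proof.
split; [exact: rad_independent|exact: rad1_symmetric|exact: rad2_symmetric|..].
- by rewrite abs_moment_rad ?ltry// => w; exact: normr_sign.
- by rewrite abs_moment_rad ?ltry// => w; exact: normr_sign.
Qed.

(** The dual Clarkson bound is a pointwise equality [rsum] for signs, so it feeds both the lower and
    the upper moment bound, and antisymmetry concludes. *)
Lemma abs_moment_rad_sum r : (0 < r)%R ->
  abs_moment two_coins r (rad1 \+ rad2)%R = (2 `^ (r - 2))%R%:E *
    (abs_moment two_coins r rad1 + abs_moment two_coins r rad2).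
Proof.
move=> r0; have rsum w : (`|rad1 w + rad2 w| `^ r + `|rad1 w - rad2 w| `^ r =
    2 * 2 `^ (r - 2) * (`|rad1 w| `^ r + `|rad2 w| `^ r))%R.
  rewrite /= !normr_sign powR1 powR2_subr2 /sign1 /sign2 /sign.
  have n2 : (`|1 + 1| = 2 :> R)%R by rewrite -[(1 + 1)%R]/(2%:R : R) normr_nat.
  have n0 : (0 `^ r = 0 :> R)%R by rewrite powR0// gt_eqF.
  (* For each of the four outcomes, one of the sum and the difference is 2 or -2 and the other is 0,
     so the left side is 2^r; positivity of [r] gives 0^r = 0. *)
  case: w => [[] []] /=;
    rewrite ?expr0 ?expr1 ?opprK ?subrr ?addNr -?opprD ?normrN ?normr0;
    by rewrite n2 n0 ?addr0 ?add0r.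
have [indep sym] := (rad_independent, rad2_symmetric).
apply/eqP; rewrite eq_le abs_moment_upper ?abs_moment_lower ?powR_ge0//;
  by move=> w; rewrite rsum.
Qed.

(** This example attains the bound with factor 2^(r-2): the lower one for exponents up to 2, the
    upper one from 2 on. *)
Lemma abs_moment_rademacher_sum r : (0 < r)%R ->
  exists (d : measure_display) (T : measurableType d) (P : probability T R)
         (xi eta : {RV P >-> R}),
    [/\ admissible_pair r xi eta, not_as_zero xi &
        abs_moment P r (xi \+ eta)%R =
        (2 `^ (r - 2))%R%:E * (abs_moment P r xi + abs_moment P r eta)].
Proof.
move=> r0; exists _, _, two_coins, rad1, rad2; split.
- exact: admissible_rad.
- exact: rad1_not_zero.
- exact: abs_moment_rad_sum.
Qed.

(** With [eta] zero, both sides reduce to the moment of [xi]; this attains the two bounds without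
    the factor 2^(r-2). *)
Lemma abs_moment_rademacher_zero r : (0 < r)%R ->
  exists (d : measure_display) (T : measurableType d) (P : probability T R)
         (xi eta : {RV P >-> R}),
    [/\ admissible_pair r xi eta, not_as_zero xi &
        abs_moment P r (xi \+ eta)%R = abs_moment P r xi + abs_moment P r eta].
Proof.
move=> r0; have rN0 : r != 0%R by rewrite gt_eqF.
exists _, _, two_coins, rad1, zero; split.
- split; [exact: independent_cst|exact: rad1_symmetric|
    exact: symmetric_cst0|..].
  + by rewrite abs_moment_rad ?ltry// => w; exact: normr_sign.
  + by rewrite abs_moment_cst0.
- exact: rad1_not_zero.
- rewrite abs_moment_cst0// adde0; congr abs_moment.
  by apply/funext => w /=; rewrite addr0.
Qed.

End rademacher.

Theorem corollary1 (R : realType) (rho : R) :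
  ((0 < rho)%R -> (rho <= 2)%R ->
     (forall (d : measure_display) (T : measurableType d) (P : probability T R)
        (xi eta : {RV P >-> R}), admissible_pair rho xi eta ->
        (2 `^ (rho - 2))%R%:E * (abs_moment P rho xi + abs_moment P rho eta)
          <= abs_moment P rho (xi \+ eta)%R /\
        abs_moment P rho (xi \+ eta)%R
          <= abs_moment P rho xi + abs_moment P rho eta) /\
     (exists (d : measure_display) (T : measurableType d) (P : probability T R)
        (xi eta : {RV P >-> R}),
        [/\ admissible_pair rho xi eta, not_as_zero xi &
          (2 `^ (rho - 2))%R%:E * (abs_moment P rho xi + abs_moment P rho eta)
            = abs_moment P rho (xi \+ eta)%R]) /\
     (exists (d : measure_display) (T : measurableType d) (P : probability T R)
        (xi eta : {RV P >-> R}),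
        [/\ admissible_pair rho xi eta, not_as_zero xi &
          abs_moment P rho (xi \+ eta)%R
            = abs_moment P rho xi + abs_moment P rho eta]))
  /\
  ((2 <= rho)%R ->
     (forall (d : measure_display) (T : measurableType d) (P : probability T R)
        (xi eta : {RV P >-> R}), admissible_pair rho xi eta ->
        abs_moment P rho xi + abs_moment P rho eta
          <= abs_moment P rho (xi \+ eta)%R /\
        abs_moment P rho (xi \+ eta)%R
          <= (2 `^ (rho - 2))%R%:E
             * (abs_moment P rho xi + abs_moment P rho eta)) /\
     (exists (d : measure_display) (T : measurableType d) (P : probability T R)
        (xi eta : {RV P >-> R}),
        [/\ admissible_pair rho xi eta, not_as_zero xi &
          abs_moment P rho xi + abs_moment P rho eta
            = abs_moment P rho (xi \+ eta)%R]) /\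
     (exists (d : measure_display) (T : measurableType d) (P : probability T R)
        (xi eta : {RV P >-> R}),
        [/\ admissible_pair rho xi eta, not_as_zero xi &
          abs_moment P rho (xi \+ eta)%R
            = (2 `^ (rho - 2))%R%:E
              * (abs_moment P rho xi + abs_moment P rho eta)])).
Proof.
split=> [r0 r2|r2].
- split=> [d T P xi eta adm|].
    have [indep _ sym _ _] := adm.
    split.
      apply: abs_moment_lower; rewrite ?powR_ge0// => w.
      exact: clarkson_dual_le2.
    (* The factor 1 is inserted so that the general moment bound applies with c = 1. *)
    rewrite -[leRHS]mul1e; apply: abs_moment_upper => // w.
    by rewrite mulr1 clarkson_le2.
  split; last exact: abs_moment_rademacher_zero.
  have [d [T [P [xi [eta [adm nz eq]]]]]] := abs_moment_rademacher_sum r0.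
  by exists d, T, P, xi, eta.
- have r0 : (0 < rho)%R by exact: lt_le_trans r2.
  split=> [d T P xi eta adm|].
    have [indep _ sym _ _] := adm.
    split; last first.
      apply: abs_moment_upper; rewrite ?powR_ge0// => w.
      exact: clarkson_dual_ge2.
    rewrite -[leLHS]mul1e; apply: abs_moment_lower => // w.
    by rewrite mulr1 clarkson_ge2.
  split; last exact: abs_moment_rademacher_sum.
  (* The example is unpacked because its equality is needed with the two sides exchanged. *)
  have [d [T [P [xi [eta [adm nz eq]]]]]] := abs_moment_rademacher_zero r0.
  by exists d, T, P, xi, eta.
Qed.
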